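(* Let $G$ be a finite loopless multigraph, let $m\in\mathbb{N}$, let $\mathcal{H}=(L,H,M)$ be a full $m$-fold cover of $G$, and let $e$ be an edge of $G$ with endpoints $u$ and $v$. Then $$P_{DP}(G,\mathcal{H}) \ge P_{DP}(G-e,\mathcal{H}-e) - P_{DP}(G\cdot e,\mathcal{H}\cdot e).$$ Consequently, $P_{DP}(G-e,m) - P^*_{DP}(G\cdot e,m) \le P_{DP}(G,m)$. Moreover, if for each edge $f\in E_G(u,v)\setminus\{e\}$ no edge of $M(f)$ has the same endpoints as any edge of $M(e)$, then $$P_{DP}(G,\mathcal{H}) = P_{DP}(G-e,\mathcal{H}-e) - P_{DP}(G\cdot e,\mathcal{H}\cdot e).$$ Consequently, when $e_G(u,v)=1$, $P^*_{DP}(G,m) \le P^*_{DP}(G-e,m) - P_{DP}(G\cdot e,m)$.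
   Context: All graphs are finite, nonempty, undirected, loopless multigraphs. For $u,v\in V(G)$, $E_G(u,v)$ is the set of edges with endpoints $u$ and $v$, and $e_G(u,v)=|E_G(u,v)|$. $G-e$ is $G$ with edge $e$ deleted; $G\cdot e$ is obtained by deleting $e$, identifying its endpoints into a single new vertex $w$, and deleting any resulting loops (so the other edges of $E_G(u,v)$ disappear, and each edge of $G\cdot e$ corresponds to exactly one edge of $E(G)\setminus E_G(u,v)$). A cover of a multigraph $G$ is a triple $\mathcal{H}=(L,H,M)$ where $L$ assigns to each $x\in V(G)$ a nonempty finite set $L(x)$, $H$ is a multigraph with vertex set $\bigcup_{x} L(x)$, and $M$ assigns to each $e\in E(G)$ a matching $M(e)$ in $H$ each of whose edges has one endpoint in $L(u)$ and one in $L(v)$, where $u,v$ are the endpoints of $e$; moreover (1) $L(u)\cap L(v)=\emptyset$ for distinct $u,v$; (2) $H[L(u)]$ is a complete graph $K_{|L(u)|}$ for each $u$; (3) $M(e_1)\cap M(e_2)=\emptyset$ for distinct edges $e_1,e_2$; (4) for distinct $u,v$, the set of edges of $H$ between $L(u)$ and $L(v)$ is $\bigcup_{e\in E_G(u,v)}M(e)$. An $\mathcal{H}$-coloring of $G$ is an independent set of $H$ of size $|V(G)|$ (equivalently, an independent set meeting each $L(u)$ in exactly one vertex). $\mathcal{H}$ is $m$-fold if $|L(u)|=m$ for all $u$, and a full $m$-fold cover if additionally the number of edges of $H$ between $L(u)$ and $L(v)$ is $e_G(u,v)\,m$ for all distinct $u,v$ (so each $M(e)$ is a perfect matching). $P_{DP}(G,\mathcal{H})$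 is the number of $\mathcal{H}$-colorings of $G$. For $m\in\mathbb{N}$, the DP color function $P_{DP}(G,m)$ is the minimum, and the dual DP color function $P^*_{DP}(G,m)$ is the maximum, of $P_{DP}(G,\mathcal{H})$ over all full $m$-fold covers $\mathcal{H}$ of $G$. Given a full $m$-fold cover $\mathcal{H}=(L,H,M)$ of $G$ with $L(x)=\{(x,j):j\in[m]\}$ and an edge $e$ with endpoints $u,v$: $\mathcal{H}-e=(L,H-M(e),M')$ where $M'$ is $M$ restricted to $E(G)\setminus\{e\}$; this is a full $m$-fold cover of $G-e$. Let $w$ be the vertex of $G\cdot e$ from contracting $e$. $\mathcal{H}\cdot e=(L',H'',M'')$ where $L'$ agrees with $L$ on $V(G)\setminus\{u,v\}$ and $L'(w)=\{(w,j):j\in[m]\}$; $H''$ is obtained from $H$ by contracting, for each $j\in[m]$, the edge of $M(e)$ with endpoint $(u,j)$ into the vertex $(w,j)$, and then deleting edges so that $H''[L'(w)]$ is $K_m$; $M''(f)=M(f)$ for each edge $f$ of $G\cdot e$ not incident to $w$; if $f$ is incident to $w$ and corresponds to the edge $f'$ of $G$ incident to $u$ (resp. $v$), then $M''(f)$ is obtained from $M(f')$ by replacing the endpoint $(u,j)$ by $(w,j)$ for each $j$ (resp. replacing the endpoint $(v,j)$ by $(w,j')$, where $(u,j')$ is the other endpoint of the edge of $M(e)$ containing $(v,j)$). This is a full $m$-fold cover of $G\cdot e$. *)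

(* Defs.v *)
From mathcomp Require Import all_boot all_order all_algebra.
From Stdlib Require Import ClassicalEpsilon.

Set Implicit Arguments.
Unset Strict Implicit.
Unset Printing Implicit Defensive.

Record multigraph := Multigraph {
  vert :> finType;
  edge : finType;
  ends : edge -> {set vert};
  ends_card : forall e, #|ends e| == 2;
  vert_gt0 : 0 < #|vert| }.

Arguments ends {m} _.

Definition edges_at (G : multigraph) (u v : G) : {set edge G} :=
  [set e | ends e == [set u; v]].

Definition mult (G : multigraph) (u v : G) : nat := #|edges_at u v|.

Definition edges_between (G : multigraph) (A B : {set G}) : {set edge G} :=
  [set e | [exists a in A, exists b in B, ends e == [set a; b]]].

Definition matching (G : multigraph) (A : {set edge G}) : Prop :=
  forall a b, a \in A -> b \in A -> a != b -> [disjoint ends a & ends b].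

Definition complete_on (G : multigraph) (A : {set G}) : Prop :=
  forall a b, a \in A -> b \in A -> a != b -> mult a b = 1.

Definition independent (G : multigraph) (S : {set G}) : bool :=
  [forall e : edge G, ~~ (ends e \subset S)].

Section Deletion.
Variables (G : multigraph) (D : {set edge G}).

Definition del_edge_type : finType := {e : edge G | e \notin D}.

Definition del_ends (e : del_edge_type) : {set G} := ends (val e).

Lemma del_ends_card e : #|del_ends e| == 2.
Proof. exact: ends_card. Qed.

Definition del_edges : multigraph := Multigraph del_ends_card (vert_gt0 G).

End Deletion.

(* Contraction of an edge set A: a new vertex is a connected component of the *)
(* spanning subgraph with edge set A, each remaining edge is attached to the  *)
(* components of its old endpoints, and the edges that become loops are       *)
(* dropped.                                                                   *)
Section Contraction.
Variables (G : multigraph) (A : {set edge G}).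

Definition component (a : G) : {set G} :=
  [set b | connect [rel x y | [exists e in A, ends e == [set x; y]]] a b].

Definition contract_vert : finType :=
  {B : {set G} | B \in component @: [set: G]}.

Definition comp_of (a : G) : contract_vert :=
  Sub (component a) (imset_f component (in_setT a)).

Definition contract_edge : finType :=
  {e : edge G | #|comp_of @: ends e| == 2}.

Definition contract_ends (e : contract_edge) : {set contract_vert} :=
  comp_of @: ends (val e).

Lemma contract_ends_card e : #|contract_ends e| == 2.
Proof. exact: (valP e). Qed.

Lemma contract_vert_gt0 : 0 < #|contract_vert|.
Proof.
by have /card_gt0P[x _] := vert_gt0 G; apply/card_gt0P; exists (comp_of x).
Qed.

Definition contract : multigraph :=
  Multigraph contract_ends_card contract_vert_gt0.

End Contraction.

Definition delete_edge (G : multigraph) (e : edge G) : multigraph :=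
  del_edges [set e].

Definition contract_one (G : multigraph) (e : edge G) : multigraph :=
  contract [set e].

Record cover_data (G : multigraph) := CoverData {
  coverH : multigraph;
  coverL : G -> {set coverH};
  coverM : edge G -> {set edge coverH} }.

Arguments coverL {G} _ _.
Arguments coverM {G} _ _.

Record is_cover (G : multigraph) (C : cover_data G) : Prop := IsCover {
  coverL_neq0 : forall x, coverL C x != set0;
  coverL_cover : \bigcup_x coverL C x = [set: coverH C];
  coverM_matching : forall e, matching (coverM C e);
  coverM_between : forall e u v, ends e = [set u; v] ->
    coverM C e \subset edges_between (coverL C u) (coverL C v);
  coverL_disjoint : forall u v, u != v -> [disjoint coverL C u & coverL C v];
  coverL_complete : forall u, complete_on (coverL C u);
  coverM_disjoint : forall e1 e2, e1 != e2 ->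
    [disjoint coverM C e1 & coverM C e2];
  coverM_cross : forall u v, u != v ->
    edges_between (coverL C u) (coverL C v)
      = \bigcup_(e in edges_at u v) coverM C e }.

Definition fold_cover (G : multigraph) (m : nat) (C : cover_data G) : Prop :=
  is_cover C /\ forall u, #|coverL C u| = m.

Definition full_cover (G : multigraph) (m : nat) (C : cover_data G) : Prop :=
  fold_cover m C /\
  forall u v, u != v ->
    #|edges_between (coverL C u) (coverL C v)| = mult u v * m.

Definition colorings (G : multigraph) (C : cover_data G) :
    {set {set coverH C}} :=
  [set S : {set coverH C} | independent S & #|S| == #|G|].

Definition num_col (G : multigraph) (C : cover_data G) : nat := #|colorings C|.

Definition cover_delete (G : multigraph) (C : cover_data G) (e : edge G) :
    cover_data (delete_edge e) :=
  @CoverData (delete_edge e) (del_edges (coverM C e)) (coverL C)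
    (fun f => [set z | val z \in coverM C (val f)]).

(* The edges of the contracted graph that lie inside L'(w) and do not come    *)
(* from the complete graph H[L(u)]; removing them leaves K_m on L'(w).        *)
Definition surplus (G : multigraph) (C : cover_data G) (e : edge G) (u : G) :
    {set edge (contract (coverM C e))} :=
  [set z | (ends (val z) \subset \bigcup_(x in ends e) coverL C x)
           && ~~ (ends (val z) \subset coverL C u)].

(* Here u is an endpoint of e. The contracted vertex (w, j) is represented by *)
(* the component consisting of (u, j) and its M(e)-partner, and every other   *)
(* vertex by its singleton. The edges of H'' are edges of H with endpoints    *)
(* replaced by their components, so M''(f) consists of the same edges as      *)
(* M(f'), where f' is the edge of G underlying f.                             *)
Definition cover_contract (G : multigraph) (C : cover_data G) (e : edge G)
    (u : G) : cover_data (contract_one e) :=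
  @CoverData (contract_one e) (del_edges (surplus C e u))
    (fun B => comp_of (coverM C e) @: \bigcup_(x in val B) coverL C x)
    (fun f => [set z | val (val z) \in coverM C (val f)]).

Definition dp_value (G : multigraph) (m n : nat) : Prop :=
  exists2 C : cover_data G, full_cover m C & num_col C = n.

Definition is_minimum (P : nat -> Prop) (n : nat) : Prop :=
  P n /\ forall k, P k -> n <= k.

Definition is_maximum (P : nat -> Prop) (n : nat) : Prop :=
  P n /\ forall k, P k -> k <= n.

(* For m > 0 the minimum and the maximum exist (P_DP_spec, P_DP_dual_spec).   *)
Definition P_DP (G : multigraph) (m : nat) : nat :=
  epsilon (inhabits 0) (is_minimum (dp_value G m)).

Definition P_DP_dual (G : multigraph) (m : nat) : nat :=
  epsilon (inhabits 0) (is_maximum (dp_value G m)).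

(* The full cover in which every M(e) joins equal labels. *)
Section TrivialCover.
Variables (G : multigraph) (m : nat) (m_gt0 : 0 < m).

Let tV : finType := (G * 'I_m)%type.
Let tK : finType := {p : G * ('I_m * 'I_m) | p.2.1 < p.2.2}.
Let tE : finType := (tK + edge G * 'I_m)%type.

Definition triv_ends (a : tE) : {set tV} :=
  match a with
  | inl k => [set ((val k).1, (val k).2.1); ((val k).1, (val k).2.2)]
  | inr p => [set (x, p.2) | x in ends p.1]
  end.

Lemma triv_ends_card a : #|triv_ends a| == 2.
Proof.
case: a => [[[x [i j]] lt_ij]|[e i]] /=.
  rewrite cards2 xpair_eqE eqxx /= -val_eqE /=.
  by move: lt_ij => /=; case: ltngtP.
by rewrite card_imset ?ends_card // => x y [].
Qed.

Lemma triv_vert_gt0 : 0 < #|tV|.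
Proof. by rewrite card_prod card_ord muln_gt0 vert_gt0. Qed.

Definition triv_cover : cover_data G :=
  @CoverData G (Multigraph triv_ends_card triv_vert_gt0)
    (fun x => [set p : tV | p.1 == x])
    (fun e => [set z : tE | if z is inr p then p.1 == e else false]).

Lemma triv_inr_ends e i u v : ends e = [set u; v] ->
  triv_ends (inr (e, i)) = [set (u, i); (v, i)].
Proof. by move=> /= ->; rewrite imsetU1 imset_set1. Qed.

Lemma triv_cross u v : u != v ->
  edges_between (coverL triv_cover u) (coverL triv_cover v)
    = [set inr p | p in setX (edges_at u v) [set: 'I_m]].
Proof.
move=> uv; apply/setP => z; rewrite inE.
apply/existsP/imsetP => [[[a i] /andP[]]|[[e i]]].
  rewrite inE /= => /eqP -> {a} /existsP[[b j] /andP[]].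
  rewrite inE /= => /eqP -> {b} /eqP.
  case: z => [[[x [k l]] lt_kl]|[e k]].
    move=> /setP E.
    have := E (u, i); have := E (v, j); rewrite !inE !eqxx orbT /=.
    rewrite !xpair_eqE => vx ux; case/negP: uv; apply/eqP.
    by case/orP: vx => /andP[/eqP -> _]; case/orP: ux => /andP[/eqP -> _].
  move=> /setP E; exists (e, k) => //; rewrite !inE /= andbT.
  have mE x y : ((x, y) \in [set (w, k) | w in ends e]) = (x \in ends e) && (y == k).
    apply/imsetP/andP => [[w we [-> ->]]|[xe /eqP ->]]; last by exists x.
    by rewrite we eqxx.
  have /andP[_ /eqP ik] : (u \in ends e) && (i == k).
    by rewrite -mE E !inE eqxx.
  have /andP[_ /eqP jk] : (v \in ends e) && (j == k).
    by rewrite -mE E !inE eqxx orbT.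
  apply/eqP/setP => x; have := E (x, k); rewrite mE eqxx andbT => ->.
  by rewrite !inE !xpair_eqE ik jk eqxx !andbT.
rewrite !inE andbT /= => /eqP ee ->; exists (u, i); rewrite inE eqxx /=.
apply/existsP; exists (v, i); rewrite inE eqxx /=.
exact/eqP/triv_inr_ends.
Qed.

Lemma triv_coverP : full_cover m triv_cover.
Proof.
have ends_neq (e : edge G) u v : ends e = [set u; v] -> u != v.
  by move=> ee; have := ends_card e; rewrite ee cards2; case: (u != v).
split; last first.
  move=> u v uv; rewrite triv_cross // card_imset; last by move=> ? ? [].
  by rewrite cardsX cardsT card_ord.
split; last first.
  move=> u; have -> : coverL triv_cover u = setX [set u] [set: 'I_m].
    by apply/setP => -[x i]; rewrite !inE andbT.
  by rewrite cardsX cards1 cardsT card_ord mul1n.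
split.
- by move=> x; apply/set0Pn; exists (x, Ordinal m_gt0); rewrite inE.
- apply/setP => -[x i].
  by rewrite in_setT; apply/bigcupP; exists x; rewrite ?inE.
- move=> e [?|[e1 i]] b; rewrite inE // => /eqP/= ->.
  case: b => [?|[e2 j]]; rewrite inE // => /eqP/= -> ij.
  rewrite -setI_eq0; apply/eqP/setP => -[x k]; rewrite !inE; apply/negbTE/negP.
  case/andP => /imsetP[y _ [_ ki]] /imsetP[z _ [_ kj]].
  by case/eqP: ij; rewrite -ki -kj.
- move=> e u v ee; rewrite triv_cross ?(ends_neq e) //.
  apply/subsetP => -[?|[e1 i]]; rewrite inE // => /eqP/= ->.
  by apply/imsetP; exists (e, i); rewrite // !inE ee eqxx.
- move=> u v uv; rewrite -setI_eq0; apply/eqP/setP => -[x i]; rewrite !inE /=.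
  by case: eqP => //= ->; apply/negbTE.
- move=> u [a i] [b j]; rewrite !inE /= => /eqP -> /eqP -> {a b}.
  wlog lt_ij : i j / i < j.
    move=> H ij; case: (ltngtP i j) => [/H|/H|/val_inj e_ij].
    + exact.
    + move=> <-; last by rewrite eq_sym.
      by rewrite /mult; congr #|pred_of_set _|; apply/setP => z; rewrite !inE setUC.
    + by rewrite e_ij eqxx in ij.
  move=> _; apply/eqP/cards1P.
  exists (inl (exist _ (u, (i, j)) lt_ij)); apply/setP => z; rewrite !inE.
  apply/eqP/eqP => [/setP E|-> //].
  have := E (u, i); have := E (u, j); rewrite !inE !eqxx orbT /=.
  case: z E => [[[x [k l]] lt_kl]|[e k]] E /=.
    rewrite !inE !xpair_eqE /= => /orP jx /orP ix.
    have [ex [ek el]] : u = x /\ i = k /\ j = l.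
      have lt_kl' : k < l := lt_kl.
      case: jx => /andP[/eqP ux /eqP jE]; case: ix => /andP[_ /eqP iE] //.
      + by move: lt_ij; rewrite iE jE ltnn.
      + by move: lt_ij; rewrite iE jE ltnNge (ltnW lt_kl').
      + by move: lt_ij; rewrite iE jE ltnn.
    by subst; congr inl; apply/val_inj.
  case/imsetP=> x _ [_ jk] /imsetP[y _ [_ ik]].
  by have := lt_ij; rewrite {1}ik {1}jk ltnn.
- move=> e1 e2 e12; rewrite -setI_eq0; apply/eqP/setP => -[?|[e i]].
    by rewrite !inE.
  by rewrite !inE /=; case: eqP => //= ->; apply/negbTE.
- move=> u v uv; rewrite triv_cross //; apply/setP => z.
  apply/imsetP/bigcupP => [[[e i]]|[e]].
    by rewrite !inE andbT => /= ee ->; exists e; rewrite ?inE.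
  rewrite !inE => ee; case: z => // -[e1 i] /eqP /= ->.
  by exists (e, i); rewrite // !inE ee.
Qed.

End TrivialCover.

Lemma dp_value_ex (G : multigraph) (m : nat) : 0 < m ->
  exists n, dp_value G m n.
Proof.
by move=> m_gt0; exists (num_col (triv_cover G m_gt0)); eexists; first exact: triv_coverP.
Qed.

Lemma dp_value_le (G : multigraph) (m n : nat) :
  dp_value G m n -> n <= 2 ^ (#|G| * m).
Proof.
case=> C [[cC Lm] _] <-.
have cH : #|coverH C| <= #|G| * m.
  rewrite -cardsT -(coverL_cover cC) -sum_nat_const.
  apply: (big_ind2 (fun (A : {set coverH C}) k => #|A| <= k)).
  - by rewrite cards0.
  - move=> A a B b hA hB; apply: leq_trans (leq_add hA hB).
    by rewrite cardsU leq_subr.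
  - by move=> x _; rewrite Lm.
apply: leq_trans (max_card _) _.
by rewrite -cardsT -powersetT card_powerset cardsT leq_exp2l.
Qed.

Lemma P_DP_spec (G : multigraph) (m : nat) : 0 < m ->
  is_minimum (dp_value G m) (P_DP G m).
Proof.
move=> m_gt0; apply: epsilon_spec.
have [n Pn] := dp_value_ex G m_gt0.
elim/ltn_ind: n Pn => n IH Pn.
have [[k [Pk lt_kn]]|noP] := classic (exists k, dp_value G m k /\ k < n).
  exact: IH lt_kn Pk.
exists n; split=> // k Pk; rewrite leqNgt; apply/negP => lt_kn.
by apply: noP; exists k.
Qed.

Lemma P_DP_dual_spec (G : multigraph) (m : nat) : 0 < m ->
  is_maximum (dp_value G m) (P_DP_dual G m).
Proof.
move=> m_gt0; apply: epsilon_spec.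
have [n0 Pn0] := dp_value_ex G m_gt0.
set b := 2 ^ (#|G| * m).
move Ed : (b - n0) => d; elim/ltn_ind: d n0 Pn0 Ed => d IH n Pn Ed.
have [[k [Pk lt_nk]]|noP] := classic (exists k, dp_value G m k /\ n < k).
  apply: (IH (b - k) _ k Pk erefl).
  by rewrite -Ed; apply: ltn_sub2l (leq_trans lt_nk (dp_value_le Pk)) lt_nk.
exists n; split=> // k Pk; rewrite leqNgt; apply/negP => lt_nk.
by apply: noP; exists k.
Qed.

(* Main.v *)
Require Import Defs.
From mathcomp Require Import all_boot all_order all_algebra.

(* The colorings of H - M(e) that are not colorings of H are those choosing   *)
(* both ends of some edge of M(e). Their image under the contraction of M(e)  *)
(* is a coloring of H'', and such a set is a union of contracted classes, so  *)
(* it is recovered from its image: this gives the inequality. A coloring of   *)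
(* H'' fails to be such an image only if its preimage contains the ends of an *)
(* edge of some M(f), f <> e, that is parallel to an edge of M(e), which the  *)
(* extra hypothesis rules out. The bounds on the color functions follow by    *)
(* applying this to an extremal cover.                                        *)

(** Restoring M(e) in H - M(e) can only destroy colorings, and the destroyed ones ([lost_colorings])
    are the sets S that contain both ends of an edge of M(e). Such an S has exactly one vertex over
    each of u and v, and these two are matched by M(e), so S is the full preimage of its image in
    H'' ([lost_coloring_saturated]). Taking images is therefore injective, and it lands in the
    colorings of H'' ([comp_of_lost_inj], [comp_of_lost_coloring]): this is the inequality.

    Conversely, the preimage of a coloring of H'' is a lost coloring unless it contains both ends of
    an edge of some M(f), f parallel to e, that joins the two vertices of one contracted pair. The
    extra hypothesis excludes this, so the map becomes a bijection ([comp_of_lost_surj]).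

    The bounds on the color functions apply these counts to an extremal cover of G. They require H -
    M(e) and H'' to be full covers again; this is checked through the equivalent notion [labelling]
    ([full_cover_labelling], [labelling_full_cover]). *)

Set Implicit Arguments.
Unset Strict Implicit.
Unset Printing Implicit Defensive.

(** * Endpoints, matchings and components of contracted edge sets *)

Section Multigraphs.
Variable G : multigraph.
Implicit Types (e f : edge G) (A : {set edge G}) (x y : G).

Lemma ends_other e x : x \in ends e ->
  exists2 y, y != x & ends e = [set x; y].
Proof.
have /cards2P[a [b [ab ->]]] := ends_card e.
rewrite !inE => /orP[]/eqP ->; first by exists b; rewrite // eq_sym.
by exists a; rewrite // setUC.
Qed.

Lemma ends_neq e x y : ends e = [set x; y] -> x != y.
Proof. by move=> E; have := ends_card e; rewrite E cards2; case: (x != y). Qed.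

Lemma ends_eq2 e x y : x != y -> ends e \subset [set x; y] ->
  ends e = [set x; y].
Proof.
move=> xy sub; apply/eqP.
by rewrite eqEcard sub cards2 xy (eqP (ends_card e)).
Qed.

Lemma matching_eq A e f x : matching A -> e \in A -> f \in A ->
  x \in ends e -> x \in ends f -> e = f.
Proof.
move=> mA eA fA xe xf; apply/eqP/negP => /negP ef.
by have /disjointFr/(_ xe) := mA _ _ eA fA ef; rewrite xf.
Qed.

Lemma eq_matching A :
  (forall e f x, e \in A -> f \in A -> x \in ends e -> x \in ends f -> e = f) ->
  matching A.
Proof.
move=> H e f eA fA /eqP ef; rewrite disjoint_subset; apply/subsetP => x xe.
by rewrite inE; apply/negP => xf; apply: ef; apply: H xf.
Qed.

Lemma matching1 e : matching [set e].
Proof. by apply: eq_matching => f g x /set1P -> /set1P ->. Qed.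

Lemma mem_comp_of A x y : (y \in val (comp_of A x)) = (comp_of A y == comp_of A x).
Proof.
have sym : connect_sym [rel x y | [exists e in A, ends e == [set x; y]]].
  apply: sym_connect_sym => a b /=.
  by apply: eq_existsb => f; rewrite (setUC [set a]).
rewrite /= inE; apply/idP/eqP => [c|/(congr1 val)/= /setP/(_ y)].
  by apply/val_inj/setP => z; rewrite /= !inE (same_connect sym c).
by rewrite !inE connect0.
Qed.

Lemma comp_of_edge A e x y : e \in A -> ends e = [set x; y] ->
  comp_of A x = comp_of A y.
Proof.
move=> eA E; apply/esym/eqP; rewrite -mem_comp_of /= inE.
by apply: connect1 => /=; apply/existsP; exists e; rewrite eA E /=.
Qed.

(** Along a path in a matching, the step after an edge must use that same edge, so it returns to the
    start; components are thus single vertices or matched pairs. *)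
Lemma comp_of_eqP A x y : matching A -> comp_of A x = comp_of A y ->
  x = y \/ exists2 e, e \in A & ends e = [set x; y].
Proof.
move=> mA /(congr1 val)/= /setP/(_ y); rewrite !inE connect0.
case/connectP => p + ->; elim/last_ind: p => [|p z IHp]; first by left.
rewrite rcons_path last_rcons => /andP[/IHp{}IHp /existsP[f /andP[fA /eqP F]]].
case: IHp F => [<- F|[e eA E] F]; first by right; exists f.
have ef : e = f.
  by apply: (matching_eq (x := last x p) mA eA fA); rewrite ?E ?F !inE eqxx ?orbT.
left; have : x \in ends f by rewrite -ef E !inE eqxx.
by rewrite F !inE (negbTE (ends_neq E)) => /eqP.
Qed.

Lemma comp_of_surj A (B : contract_vert A) : exists x, B = comp_of A x.
Proof. by case/imsetP: (valP B) => x _ E; exists x; apply: val_inj. Qed.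

(** Universal property of the quotient; it is what lets [l] descend to H''. The default [x0] only
    makes the choice total. *)
Lemma comp_of_factor A (T : Type) (h : G -> T) :
  (forall x y, comp_of A x = comp_of A y -> h x = h y) ->
  exists h' : contract A -> T, forall x, h' (comp_of A x) = h x.
Proof.
move=> hP; have /card_gt0P[x0 _] := vert_gt0 G.
exists (fun B => h (odflt x0 [pick x | comp_of A x == B])) => x.
by case: pickP => [y /eqP/hP //|/(_ x)]; rewrite eqxx.
Qed.

Lemma edges_atP e x y : reflect (ends e = [set x; y]) (e \in edges_at x y).
Proof. by rewrite inE; apply: eqP. Qed.

End Multigraphs.

Lemma independent_delP (H : multigraph) (D : {set edge H}) (S : {set H}) :
  reflect (forall z, z \notin D -> ~~ (ends z \subset S))
    (@independent (del_edges D) S).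
Proof.
apply: (iffP forallP) => [indS z zD|indS [z zD]]; last exact: indS.
exact: (indS (exist _ z zD)).
Qed.

Lemma card_bigcup_disjoint (I T : finType) (F : I -> {set T}) (P : pred I) :
  (forall i j, i != j -> [disjoint F i & F j]) ->
  #|\bigcup_(i | P i) F i| = \sum_(i | P i) #|F i|.
Proof.
move=> dF; rewrite big_mkcond [RHS]big_mkcond -sum1_card.
rewrite partition_disjoint_bigcup => [|i j /dF dij].
  by apply: eq_bigr => i _; rewrite sum1_card; case: (P i); rewrite ?cards0.
case: (P i); case: (P j) => //; rewrite -setI_eq0 ?set0I ?setI0 //.
Qed.

(* A full cover with its data spread out along the projection [l] sending a   *)
(* vertex of H to the x with the vertex in L(x); in this form the conditions  *)
(* are pointwise and are easily transported to H - M(e) and to H''.           *)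
Record labelling (G : multigraph) (m : nat) (C : cover_data G)
    (l : coverH C -> G) : Prop := Labelling {
  lab_coverL : forall x a, (a \in coverL C x) = (l a == x);
  lab_card : forall x, #|coverL C x| = m;
  lab_edge : forall a b, a != b -> l a = l b -> exists z, ends z = [set a; b];
  lab_edge_inj : forall a b z z', l a = l b ->
    ends z = [set a; b] -> ends z' = [set a; b] -> z = z';
  lab_ends : forall f z, z \in coverM C f -> l @: ends z = ends f;
  lab_cross : forall z, #|l @: ends z| = 2 -> exists f, z \in coverM C f;
  lab_disjoint : forall f g z, z \in coverM C f -> z \in coverM C g -> f = g;
  lab_perfect : forall f a, l a \in ends f ->
    exists2 z, z \in coverM C f & a \in ends z;
  lab_matching : forall f, matching (coverM C f) }.

Arguments labelling {G} m C l.

(** * Full covers are the same as labellings *)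

Section Labelling.
Variables (G : multigraph) (m : nat) (C : cover_data G).

Lemma labelling_ex : is_cover C ->
  exists l : coverH C -> G, forall x a, (a \in coverL C x) = (l a == x).
Proof.
move=> cC; have /card_gt0P[x0 _] := vert_gt0 G.
exists (fun a => odflt x0 [pick x | a \in coverL C x]) => x a.
case: pickP => [y ay|noL] /=.
  apply/idP/eqP => [ax|<- //]; apply/eqP/negP => /negP yx.
  by have /disjointFr/(_ ay) := coverL_disjoint cC yx; rewrite ax.
have := in_setT a; rewrite -(coverL_cover cC) => /bigcupP[y _].
by rewrite noL.
Qed.

(** Names the endpoint of z over x, so that edges of M(f) can be counted by vertices of L(x). *)
Lemma endpoint_ex (l : coverH C -> G) :
  exists g : edge (coverH C) -> G -> coverH C,
    forall z x, x \in l @: ends z -> g z x \in ends z /\ l (g z x) = x.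
Proof.
have /card_gt0P[a0 _] := vert_gt0 (coverH C).
exists (fun z x => odflt a0 [pick a | (a \in ends z) && (l a == x)]) => z x.
case: pickP => [a /andP[az /eqP lx] //|no] /imsetP[a az ax].
by have := no a; rewrite az -ax eqxx.
Qed.

Lemma edges_betweenP (l : coverH C -> G) x y z :
  (forall x a, (a \in coverL C x) = (l a == x)) -> x != y ->
  reflect (l @: ends z = [set x; y])
    (z \in edges_between (coverL C x) (coverL C y)).
Proof.
move=> lP xy; rewrite inE; apply: (iffP existsP) => [[a /andP[]]|E].
  rewrite lP => /eqP ax /existsP[b /andP[]]; rewrite lP => /eqP bx /eqP ->.
  by rewrite imsetU1 imset_set1 ax bx.
have /imsetP[a az ax] : x \in l @: ends z by rewrite E !inE eqxx.
have /imsetP[b bz bx] : y \in l @: ends z by rewrite E !inE eqxx orbT.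
exists a; rewrite lP ax eqxx; apply/existsP; exists b; rewrite lP bx eqxx /=.
apply/eqP; have [c ca Ec] := ends_other az; rewrite Ec.
move: bz; rewrite Ec !inE => /orP[]/eqP ba; last by rewrite ba.
by rewrite ax bx ba eqxx in xy.
Qed.

(** The point is perfection of each M(f): a matching injects into L(x), so it has at most m edges,
    and the total e(x,y) m over parallel edges forces equality for every f. *)
Lemma full_cover_labelling : full_cover m C -> exists l, labelling m C l.
Proof.
case=> -[cC Lm] full; have [l lP] := labelling_ex cC.
have Mends f z : z \in coverM C f -> l @: ends z = ends f.
  have /cards2P[x [y [xy E]]] := ends_card f.
  move=> /(subsetP (coverM_between cC E)) => /(edges_betweenP _ lP xy) ->.
  by rewrite E.
have [g gP] := endpoint_ex l.
have ginj f x : x \in ends f -> {in coverM C f &, injective (g^~ x)}.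
  move=> xf z z' zM zM' /= E.
  have [|gz _] := gP z x; first by rewrite (Mends _ _ zM).
  have [|gz' _] := gP z' x; first by rewrite (Mends _ _ zM').
  by apply: (matching_eq (@coverM_matching _ _ cC f) zM zM' gz); rewrite E.
have gsub f x : x \in ends f -> g^~ x @: coverM C f \subset coverL C x.
  move=> xf; apply/subsetP => _ /imsetP[z zM ->].
  by have [|_ /eqP] := gP z x; rewrite ?(Mends _ _ zM) ?lP.
have Mle f : #|coverM C f| <= m.
  have /cards2P[x [y [xy E]]] := ends_card f.
  have xf : x \in ends f by rewrite E !inE eqxx.
  by rewrite -(card_in_imset (ginj _ _ xf)) -(Lm x) subset_leq_card ?gsub.
have Meq f : #|coverM C f| = m.
  have /cards2P[x [y [xy E]]] := ends_card f.
  have := full _ _ xy; rewrite (coverM_cross cC xy).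
  rewrite (card_bigcup_disjoint _ (coverM_disjoint cC)) /mult -sum_nat_const.
  move=> sumE; apply/eqP; rewrite eqn_leq Mle /= -subn_eq0.
  (* The deficits m - |M(f)| are natural numbers with sum 0, so each of them vanishes. *)
  have : \sum_(f in edges_at x y) (m - #|coverM C f|) == 0.
    by rewrite sumnB ?sumE ?subnn.
  by rewrite sum_nat_eq0 => /forall_inP; apply; apply/edges_atP.
exists l; split => //.
- move=> a b ab lab; have /eqP/cards1P[z Z] : mult a b = 1.
    by apply: (coverL_complete cC (u := l a)); rewrite ?lP ?lab.
  by exists z; apply/edges_atP; rewrite Z set11.
- move=> a b z z' lab E E'; have /eqP/cards1P[t T] : mult a b = 1.
    by apply: (coverL_complete cC (u := l a)); rewrite ?lP ?lab // (ends_neq E).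
  by move: E E' => /edges_atP + /edges_atP; rewrite T => /set1P -> /set1P ->.
- move=> z /eqP/cards2P[x [y [xy /(edges_betweenP _ lP xy)]]].
  by rewrite (coverM_cross cC xy) => /bigcupP[f _ zM]; exists f.
- move=> f f' z zM zM'; apply/eqP/negP => /negP ff'.
  by have /disjointFr/(_ zM) := coverM_disjoint cC ff'; rewrite zM'.
(* An injection between two sets of size m is onto. *)
- move=> f a af; have gE : g^~ (l a) @: coverM C f = coverL C (l a).
    by apply/eqP; rewrite eqEcard gsub //= card_in_imset ?Meq ?Lm //; apply: ginj.
  have : a \in coverL C (l a) by rewrite lP.
  rewrite -gE => /imsetP[z zM aE]; exists z => //.
  by have [|gz _] := gP z (l a); rewrite ?(Mends _ _ zM) // aE.
- exact: coverM_matching.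
Qed.

Lemma lab_inj_ends (l : coverH C -> G) z : #|l @: ends z| = 2 ->
  {in ends z &, injective l}.
Proof. by move=> E; apply/imset_injP; rewrite E (eqP (ends_card z)). Qed.

(** Perfect matchings make the endpoint over x a bijection from M(f) to L(x), which gives |M(f)| =
    m; positivity of m makes the lists nonempty. *)
Lemma labelling_full_cover (l : coverH C -> G) : 0 < m -> labelling m C l ->
  full_cover m C.
Proof.
move=> m_gt0 labl; have lP := lab_coverL labl.
have ends2 f z : z \in coverM C f -> #|l @: ends z| = 2.
  by move=> /(lab_ends labl) ->; apply/eqP/ends_card.
have [g gP] := endpoint_ex l.
have Meq f : #|coverM C f| = m.
  have /cards2P[x [y [xy E]]] := ends_card f.
  have xf : x \in ends f by rewrite E !inE eqxx.
  have xz z : z \in coverM C f -> g z x \in ends z /\ l (g z x) = x.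
    by move=> zM; apply: gP; rewrite (lab_ends labl zM).
  rewrite -(lab_card labl x) -(card_in_imset (f := g^~ x)).
    congr #|pred_of_set _|; apply/setP => a; rewrite lP.
    apply/imsetP/eqP => [[z /xz[_ gx] ->] //|ax].
    have [z zM az] := lab_perfect labl (f := f) (a := a) ltac:(by rewrite ax).
    have [gz gx] := xz _ zM; exists z => //.
    by apply: (lab_inj_ends (ends2 _ _ zM)); rewrite ?gx.
  move=> z z' zM zM' E'; have [gz _] := xz _ zM; have [gz' _] := xz _ zM'.
  by apply: (matching_eq (@lab_matching _ _ _ _ labl f) zM zM' gz); rewrite E'.
have disj f f' : f != f' -> [disjoint coverM C f & coverM C f'].
  move=> /eqP ff'; rewrite disjoint_subset; apply/subsetP => z zM; rewrite inE.
  by apply/negP => zM'; apply: ff'; apply: (lab_disjoint labl) zM zM'.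
have cross x y : x != y -> edges_between (coverL C x) (coverL C y)
    = \bigcup_(f in edges_at x y) coverM C f.
  move=> xy; apply/setP => z; apply/(edges_betweenP _ lP xy)/bigcupP.
    move=> E; have [|f zM] := lab_cross labl (z := z); first by rewrite E cards2 xy.
    by exists f => //; apply/edges_atP; rewrite -(lab_ends labl zM).
  by case=> f /edges_atP <- /(lab_ends labl).
split; last first.
  move=> x y xy; rewrite cross // (card_bigcup_disjoint _ disj) /mult -sum_nat_const.
  by apply: eq_bigr => f _.
split; last exact: lab_card labl.
split=> //.
- by move=> x; rewrite -card_gt0 (lab_card labl).
- by apply/setP => a; rewrite in_setT; apply/bigcupP; exists (l a); rewrite ?lP.
- exact: lab_matching labl.
- move=> f x y E; apply/subsetP => z zM.
  by apply/(edges_betweenP _ lP (ends_neq E)); rewrite (lab_ends labl zM).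
- move=> x y xy; rewrite disjoint_subset; apply/subsetP => a.
  by rewrite inE !lP => /eqP ->.
- move=> x a b; rewrite !lP => /eqP ax /eqP bx ab.
  have lE : l a = l b by rewrite ax.
  have [z Z] := lab_edge labl ab lE; apply/eqP/cards1P; exists z.
  apply/setP => z'; rewrite inE; apply/edges_atP/eqP => [Z'|-> //].
  exact: lab_edge_inj labl _ _ _ _ lE Z' Z.
Qed.

Lemma lab_inj_independent (l : coverH C -> G) (S : {set coverH C}) :
  labelling m C l -> independent S -> {in S &, injective l}.
Proof.
move=> labl /forallP indS a b aS bS lE; apply/eqP/negP => /negP ab.
have [z Z] := lab_edge labl ab lE; case/negP: (indS z); rewrite Z.
by apply/subsetP => c; rewrite !inE => /orP[]/eqP ->.
Qed.

(** Each L(x) is complete, so [l] is injective on an independent set, which then has size |V(G)|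
    exactly when it meets every L(x). *)
Lemma mem_colorings (l : coverH C -> G) (S : {set coverH C}) : labelling m C l ->
  (S \in colorings C) = independent S && (l @: S == [set: G]).
Proof.
move=> labl; rewrite inE; case: (boolP (independent S)) => //= indS.
rewrite eqEcard subsetT cardsT /=.
rewrite (card_in_imset (lab_inj_independent labl indS)) eqn_leq andbC.
case: leqP => //= _; rewrite -cardsT.
rewrite -(card_in_imset (lab_inj_independent labl indS)).
exact/subset_leq_card/subsetT.
Qed.

End Labelling.

(** * Deleting and contracting an edge of a labelled cover *)

Section DeletionContraction.
Variables (G : multigraph) (m : nat) (C : cover_data G) (l : coverH C -> G).
Hypothesis labl : labelling m C l.
Variables (e : edge G) (u v : G).
Hypothesis e_uv : ends e = [set u; v].

Local Notation Me := (coverM C e).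
Local Notation cG := (comp_of [set e]).
Local Notation cH := (comp_of Me).

Let uv : u != v. Proof. exact: ends_neq e_uv. Qed.
Let mMe : matching Me. Proof. exact: (@lab_matching _ _ _ _ labl). Qed.

Lemma lab_M_ends2 f z : z \in coverM C f -> #|l @: ends z| = 2.
Proof. by move=> zM; rewrite (lab_ends labl zM); apply/eqP/ends_card. Qed.

Lemma lab_M_neq f z a b : z \in coverM C f -> ends z = [set a; b] -> l a != l b.
Proof.
move=> /lab_M_ends2 + E; rewrite E imsetU1 imset_set1 cards2.
by case: (l a != l b).
Qed.

Lemma labelling_delete : labelling m (cover_delete C e) l.
Proof.
split=> /=.
- exact: lab_coverL labl.
- exact: lab_card labl.
- move=> a b ab lE; have [z Z] := lab_edge labl ab lE.
  have zMe : z \notin Me.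
    by apply/negP => /lab_M_neq/(_ Z); rewrite lE eqxx.
  by exists (exist _ z zMe).
- move=> a b [z zP] [z' zP'] lE Z Z'; apply: val_inj => /=.
  exact: lab_edge_inj labl _ _ _ _ lE Z Z'.
- by move=> [f fP] [z zP]; rewrite inE => /(lab_ends labl).
- move=> [z zP] /(lab_cross labl)[f /= zM].
  have fP : f \notin [set e] by apply: contraNN zP => /set1P <-.
  by exists (exist _ f fP); rewrite inE.
- move=> [f fP] [f' fP'] [z zP]; rewrite !inE /= => zM zM'.
  by apply: val_inj; apply: lab_disjoint labl _ _ _ zM zM'.
- move=> [f fP] a /(lab_perfect labl)[z /= zM az].
  have zMe : z \notin Me.
    by apply: contraNN fP => /(lab_disjoint labl zM) ->; rewrite set11.
  by exists (exist _ z zMe); rewrite ?inE.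
- move=> [f fP]; apply: eq_matching => -[z zP] [z' zP'] a.
  rewrite !inE /= => zM zM' az az'; apply: val_inj.
  exact: matching_eq (@lab_matching _ _ _ _ labl f) zM zM' az az'.
Qed.

Lemma comp_of_uv : cG u = cG v.
Proof. by apply: comp_of_edge e_uv; rewrite set11. Qed.

Lemma comp_of1P x y : cG x = cG y -> x = y \/ [set x; y] = [set u; v].
Proof.
by case/(comp_of_eqP (@matching1 _ e)) => [|[f /set1P -> <-]]; [left|right].
Qed.

Lemma comp_of1_inj x y : x != v -> y != v -> cG x = cG y -> x = y.
Proof.
move=> xv yv /comp_of1P[//|/setP/(_ v)]; rewrite !inE eqxx orbT.
by rewrite !(eq_sym v) (negbTE xv) (negbTE yv).
Qed.

Lemma comp_of1_neqv x : exists2 y, y != v & cG y = cG x.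
Proof.
have [->|xv] := eqVneq x v; last by exists x.
by exists u; rewrite ?comp_of_uv.
Qed.

Lemma lab_comp_of a b : cH a = cH b -> cG (l a) = cG (l b).
Proof.
case/(comp_of_eqP mMe) => [-> //|[z zM Z]].
have := lab_ends labl zM; rewrite Z imsetU1 imset_set1 => E.
by apply: comp_of_edge (esym E); rewrite set11.
Qed.

Lemma comp_of_lab_inj a b : cH a = cH b -> l a = l b -> a = b.
Proof.
by case/(comp_of_eqP mMe) => [//|[z zM /(lab_M_neq zM)/eqP]].
Qed.

(** If [l a] and x are the two ends of e, then b is the M(e)-partner of a, which exists because M(e)
    is perfect. *)
Lemma comp_of_lift a x : cG (l a) = cG x -> exists2 b, cH b = cH a & l b = x.
Proof.
case/comp_of1P => [<-|E]; first by exists a.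
have [z zM az] : exists2 z, z \in Me & a \in ends z.
  by apply: (lab_perfect labl); rewrite e_uv -E !inE eqxx.
have [b ba Z] := ends_other az.
exists b; first by apply: esym; apply: comp_of_edge zM Z.
have lab := lab_M_neq zM Z.
have : l b \in [set l a; x].
  by rewrite E -e_uv -(lab_ends labl zM) imset_f // Z !inE eqxx orbT.
by rewrite !inE eq_sym (negbTE lab) => /eqP.
Qed.

(** Picks (u, j) as the representative of (w, j); distinct vertices of G other than v stay distinct
    after contraction. *)
Lemma comp_of_neqv (b : contract_vert Me) : exists2 a, l a != v & b = cH a.
Proof.
have [a ->] := comp_of_surj b; have [x xv E] := comp_of1_neqv (l a).
by have [a' <- lx] := comp_of_lift (esym E); exists a'; rewrite ?lx.
Qed.

(** Only x = u needs the deletion of surplus edges: of the edges inside L'(w), just those of H[L(u)]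
    survive. *)
Lemma not_surplus (z : edge (contract Me)) x : z \notin surplus C e u ->
  x != v -> (forall a, a \in ends (val z) -> cG (l a) = cG x) ->
  forall a, a \in ends (val z) -> l a = x.
Proof.
move=> zs xv H; have [xu|xu] := eqVneq x u; last first.
  move=> a /H/comp_of1P[//|/setP/(_ x)].
  by rewrite !inE eqxx orbT (negbTE xu) (negbTE xv).
move: zs; rewrite inE negb_and negbK => /orP[/subsetPn[a az]|/subsetP zL a /zL].
  case/negP; apply/bigcupP; exists (l a); last by rewrite (lab_coverL labl).
  rewrite e_uv; case/comp_of1P: (H a az) => [->|<-]; rewrite ?xu !inE eqxx //.
by rewrite (lab_coverL labl) xu => /eqP.
Qed.

Lemma labelling_contract :
  exists2 l' : coverH (cover_contract C e u) -> contract_one e,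
    forall a, l' (cH a) = cG (l a) & labelling m (cover_contract C e u) l'.
Proof.
have [l' l'E] : exists l' : contract Me -> contract_one e,
    forall a, l' (cH a) = cG (l a) := comp_of_factor lab_comp_of.
exists l' => //.
have l'im (A : {set coverH C}) : l' @: (cH @: A) = cG @: (l @: A).
  by rewrite -!imset_comp; apply: eq_imset => a /=.
have L'P B b : (b \in coverL (cover_contract C e u) B) = (l' b == B).
  have [x ->] := comp_of_surj B; have [a ->] := comp_of_surj b; rewrite l'E /=.
  apply/imsetP/eqP => [[a' /bigcupP[y]]|E].
    rewrite mem_comp_of (lab_coverL labl) => /eqP <- /eqP <-.
    exact: lab_comp_of.
  exists a => //; apply/bigcupP; exists (l a); last by rewrite (lab_coverL labl).
  by rewrite mem_comp_of E.
split=> //.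
- move=> B; have [x0 ->] := comp_of_surj B; have [x xv <-] := comp_of1_neqv x0.
  rewrite -(lab_card labl x) -(card_in_imset (f := cH)); last first.
    move=> a b; rewrite !(lab_coverL labl) => /eqP ax /eqP bx E.
    by apply: comp_of_lab_inj; rewrite // ax.
  congr #|pred_of_set _|; apply/setP => b; rewrite L'P.
  have [a ->] := comp_of_surj b; rewrite l'E.
  apply/eqP/imsetP => [/comp_of_lift[a' <- lx]|[a' + /lab_comp_of ->]].
    by exists a'; rewrite ?(lab_coverL labl) ?lx.
  by rewrite (lab_coverL labl) => /eqP ->.
- move=> b b'; have [a av ->] := comp_of_neqv b; have [a' av' ->] := comp_of_neqv b'.
  rewrite !l'E => bb' /(comp_of1_inj av av') lE.
  have [|z Z] := lab_edge labl _ lE; first by apply: contraNneq bb' => ->.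
  have zc : #|cH @: ends z| == 2 by rewrite Z imsetU1 imset_set1 cards2 bb'.
  have zs : exist _ z zc \notin surplus C e u.
    rewrite inE negb_and negbK /= orbC -implyNb; apply/implyP => nL.
    apply: contraNN nL => /subsetP/(_ a); rewrite Z !inE eqxx => /(_ isT).
    case/bigcupP => x; rewrite e_uv (lab_coverL labl) !inE => + /eqP ax.
    rewrite -ax (negbTE av) orbF => /eqP au; apply/subsetP => c.
    by rewrite !inE (lab_coverL labl) => /orP[]/eqP ->; rewrite -?lE au.
  by exists (exist (fun z => z \notin surplus C e u) (exist _ z zc) zs);
    rewrite /= /del_ends /= /contract_ends /= Z imsetU1 imset_set1.
- move=> b b' z z'; have [a av ->] := comp_of_neqv b; have [a' av' ->] := comp_of_neqv b'.
  rewrite !l'E => /(comp_of1_inj av av') lE.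
  suff ends_val (t : edge (coverH (cover_contract C e u))) :
      ends t = [set cH a; cH a'] -> ends (val (val t)) = [set a; a'].
    move=> /ends_val Z /ends_val Z'; apply/val_inj/val_inj.
    exact: lab_edge_inj labl _ _ _ _ lE Z Z'.
  case: t => -[t tc] ts T; have aa' : a != a'.
    by apply: contraNneq (ends_neq T) => ->.
  apply: ends_eq2 => //=; apply/subsetP => c ct.
  have cT d : d \in ends t -> cH d = cH a \/ cH d = cH a'.
    move=> dt; have : cH d \in [set cH a; cH a'] by rewrite -T imset_f.
    by rewrite !inE => /orP[]/eqP; [left|right].
  (* Since t is not surplus, both its ends lie over [l a] itself, where a class has at most one
     vertex; so t joins a and a'. *)
  have tl : forall d, d \in ends t -> l d = l a.
    apply: (not_surplus ts av) => d /cT[]/lab_comp_of -> //.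
    by rewrite lE.
  have lc := tl _ ct; rewrite !inE; case: (cT _ ct) => /comp_of_lab_inj E.
    by rewrite E ?eqxx.
  by rewrite E ?eqxx ?orbT // lc.
- move=> [f fP] [[z zc] zs]; rewrite inE /= => zM.
  by rewrite [LHS]l'im (lab_ends labl zM).
(* Sizes only drop from [ends z] to [l @: ends z] to its image under [cG]; being 2 at both extremes,
   they are 2 throughout. *)
- move=> [[z zc] zs]; rewrite [X in #|pred_of_set X|]l'im => E.
  have /(lab_cross labl)[f zM] : #|l @: ends z| = 2.
    apply/eqP; rewrite eqn_leq -{1}(eqP (ends_card z)) leq_imset_card /=.
    by rewrite -[X in X <= _]E leq_imset_card.
  have fP : #|cG @: ends f| == 2 by rewrite -(lab_ends labl zM) E.
  by exists (exist _ f fP); rewrite inE.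
- move=> [f fP] [f' fP'] [[z zc] zs]; rewrite !inE /= => zM zM'.
  by apply: val_inj; apply: lab_disjoint labl _ _ _ zM zM'.
- move=> [f fP] b; have [a ->] := comp_of_surj b; rewrite l'E.
  case/imsetP => x xf /comp_of_lift[a' <- lx].
  have [|z zM az] := lab_perfect labl (f := f) (a := a'); first by rewrite lx.
  have zc : #|cH @: ends z| == 2.
    rewrite eqn_leq -{1}(eqP (ends_card z)) leq_imset_card /=.
    by rewrite -(eqP fP) /= -(lab_ends labl zM) -l'im leq_imset_card.
  have zs : exist _ z zc \notin surplus C e u.
    (* An edge of M(f) inside the union of L(u) and L(v) would make f a loop of the contracted
       graph. *)
    rewrite inE negb_and; apply/orP; left; apply/negP => /= /subsetP sub.
    have: cG @: ends f \subset [set cG u].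
      apply/subsetP => _ /imsetP[y yf ->]; move: yf.
      rewrite -(lab_ends labl zM) => /imsetP[c /sub/bigcupP[y' +] + ->].
      rewrite (lab_coverL labl) e_uv => + /eqP ->.
      by rewrite !inE => /orP[]/eqP ->; rewrite ?comp_of_uv.
    by move/subset_leq_card; rewrite cards1 (eqP fP).
  by exists (exist (fun z => z \notin surplus C e u) (exist _ z zc) zs);
    rewrite ?inE //; apply: imset_f.
- move=> [f fP]; apply: eq_matching => -[[z zc] zs] [[z' zc'] zs'] b.
  rewrite !inE /= => zM zM' /imsetP[a az ->] /imsetP[a' az' E].
  apply/val_inj/val_inj => /=; have aa' : a = a'.
    (* f does not become a loop, so contraction separates its ends; a and a' then lie over the same
       end. *)
    apply: comp_of_lab_inj => //; have fi : {in ends f &, injective cG}.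
      by apply/imset_injP; rewrite (eqP fP) (eqP (ends_card f)).
    apply: fi (lab_comp_of E).
      by rewrite -(lab_ends labl zM) imset_f.
    by rewrite -(lab_ends labl zM') imset_f.
  apply: (matching_eq (@lab_matching _ _ _ _ labl f) zM zM' az).
  by rewrite aa'.
Qed.

(** * Lost colorings and their images in the contracted cover *)

Definition lost_colorings : {set {set coverH C}} :=
  (colorings (cover_delete C e) : {set {set coverH C}}) :\: colorings C.

Lemma num_col_delete :
  num_col (cover_delete C e) = num_col C + #|lost_colorings|.
Proof.
pose D : {set {set coverH C}} := colorings (cover_delete C e).
transitivity #|D| => //; rewrite -(cardsID (colorings C) D); congr (_ + _).
congr #|pred_of_set _|; apply/setIidPr/subsetP => S.
rewrite !inE => /andP[/forallP indS ->]; rewrite andbT.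
by apply/independent_delP => z _.
Qed.

Lemma lost_coloringP (S : {set coverH C}) :
  reflect [/\ forall z, ends z \subset S -> z \in Me, l @: S = [set: G]
             & exists2 z, z \in Me & ends z \subset S]
          (S \in lost_colorings).
Proof.
rewrite inE (mem_colorings _ labl) (mem_colorings _ labelling_delete).
apply: (iffP andP) => [[+ /andP[/independent_delP indS /eqP lS]]|].
  rewrite lS eqxx andbT negb_forall => /existsP[z]; rewrite negbK => zS.
  have sub t : ends t \subset S -> t \in Me.
    by move=> tS; apply: contraLR tS => /indS.
  by split=> //; exists z => //; apply: sub.
case=> sub lS [z zM zS]; split.
  by rewrite negb_and; apply/orP; left; apply/forallPn; exists z; rewrite negbK.
apply/andP; split; last exact/eqP.
by apply/independent_delP => t; apply: contraNN => /sub.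
Qed.

(** S contains both ends of some z in M(e), and these are its only vertices over u and v. Any edge
    of M(e) meeting S therefore meets z, hence equals z and lies inside S. *)
Lemma lost_coloring_saturated S a : S \in lost_colorings ->
  (cH a \in cH @: S) = (a \in S).
Proof.
move=> SX; have /lost_coloringP[sub lS [z zM zS]] := SX.
have lI : {in S &, injective l}.
  move: SX; rewrite inE (mem_colorings _ labelling_delete).
  by case/and3P=> _ indS _; apply: lab_inj_independent labelling_delete indS.
apply/imsetP/idP => [[b bS]|aS]; last by exists a.
case/(comp_of_eqP mMe) => [-> //|[t tM T]].
suff zt : z = t by apply: (subsetP zS); rewrite zt T !inE eqxx.
have : l b \in l @: ends z.
  by rewrite (lab_ends labl zM) -(lab_ends labl tM) imset_f // T !inE eqxx orbT.
case/imsetP => c cz /lI bc; apply: (matching_eq mMe zM tM cz).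
by rewrite -bc // ?(subsetP zS) // T !inE eqxx orbT.
Qed.

(** By saturation, an edge of H'' inside the image comes from an edge of H inside S, hence from
    M(e); but those edges were contracted away. *)
Lemma comp_of_lost_coloring S : S \in lost_colorings ->
  cH @: S \in colorings (cover_contract C e u).
Proof.
move=> SX; have /lost_coloringP[sub lS _] := SX.
have [l' l'E labl'] := labelling_contract.
rewrite (mem_colorings _ labl'); apply/andP; split.
  apply/independent_delP => -[z zc] _; apply/negP => /subsetP zS.
  have : ends z \subset S.
    apply/subsetP => a az; rewrite -(lost_coloring_saturated _ SX).
    by apply: zS; apply: imset_f.
  move=> /sub zM; have /cards2P[a [b [ab Z]]] := ends_card z.
  have := zc; rewrite Z imsetU1 imset_set1 cards2.
  by rewrite (comp_of_edge zM Z) eqxx.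
apply/eqP/setP => B; rewrite in_setT; have [x ->] := comp_of_surj B.
have := in_setT x; rewrite -lS => /imsetP[a aS ->].
by rewrite -l'E; do 2!apply: imset_f.
Qed.

Lemma comp_of_lost_inj :
  {in lost_colorings &, injective (fun S : {set coverH C} => cH @: S)}.
Proof.
move=> S S' SX SX' E; apply/setP => a.
by rewrite -(lost_coloring_saturated a SX) E (lost_coloring_saturated a SX').
Qed.

Lemma num_col_ge :
  num_col (cover_delete C e) <= num_col C + num_col (cover_contract C e u).
Proof.
rewrite num_col_delete leq_add2l -(card_in_imset comp_of_lost_inj).
apply/subset_leq_card/subsetP => _ /imsetP[S SX ->].
exact: comp_of_lost_coloring.
Qed.

(** The preimage of T is the required S; what has to be shown is that every edge of H inside it
    belongs to M(e). *)
Lemma comp_of_lost_surj (T : {set coverH (cover_contract C e u)}) :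
  (forall f, f \in edges_at u v :\ e ->
     forall a b, a \in coverM C f -> b \in Me -> ends a <> ends b) ->
  T \in colorings (cover_contract C e u) ->
  exists2 S, S \in lost_colorings & T = cH @: S.
Proof.
move=> nopar; have [l' l'E labl'] := labelling_contract.
rewrite (mem_colorings _ labl') => /andP[indT /eqP lT].
have l'I := lab_inj_independent labl' indT; move/independent_delP: indT => indT.
exists [set a | cH a \in T]; last first.
  apply/setP => b; have [a ->] := comp_of_surj b.
  by apply/idP/imsetP => [aT|[a' + ->]]; [exists a; rewrite ?inE|rewrite inE].
have hit x : exists2 a, cH a \in T & l a = x.
  have := in_setT (cG x : contract_one e); rewrite -lT => /imsetP[b bT].
  have [a aE] := comp_of_surj b; rewrite aE l'E => /esym/comp_of_lift[a' a'E lx].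
  by exists a' => //; rewrite a'E -aE.
apply/lost_coloringP; split.
- move=> z /subsetP zS; have [a [b [ab Z]]] : exists a b, a != b /\ ends z = [set a; b].
    exact/cards2P/ends_card.
  have [aT bT] : cH a \in T /\ cH b \in T.
    by have := zS a; have := zS b; rewrite Z !inE !eqxx orbT => -> // ->.
  (* If the ends share a class, z is parallel to an edge of M(e), and [nopar] puts z in M(e).
     Otherwise z can be absent from H'' only as a surplus edge, but T has just one vertex over w. *)
  have [ab'|ab'] := eqVneq (cH a) (cH b).
    case/(comp_of_eqP mMe): ab' => [E|[t tM tE]]; first by rewrite E eqxx in ab.
    have lz : l @: ends z = ends e by rewrite Z -tE (lab_ends labl tM).
    have [|f zM] := lab_cross labl (z := z); first by rewrite lz; apply/eqP/ends_card.
    have [<- //|fe] := eqVneq f e.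
    case: (nopar f _ z t zM tM); last by rewrite Z tE.
    by rewrite !inE fe -(lab_ends labl zM) lz e_uv /=.
  have zc : #|cH @: ends z| == 2 by rewrite Z imsetU1 imset_set1 cards2 ab'.
  have zs : exist _ z zc \in surplus C e u.
    apply: contraT => /indT/negP[]; apply/subsetP => _ /imsetP[c /= cz ->].
    by have := zS c cz; rewrite inE.
  move: zs; rewrite inE /= => /andP[/subsetP zuv _].
  have lu c : c \in ends z -> l' (cH c) = cG u.
    case/zuv/bigcupP => x; rewrite l'E e_uv (lab_coverL labl) => + /eqP ->.
    by rewrite !inE => /orP[]/eqP ->; rewrite ?comp_of_uv.
  case/eqP: ab'; apply: l'I => //; rewrite !lu // Z !inE eqxx ?orbT //.
- apply/setP => x; rewrite in_setT; have [a aT <-] := hit x.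
  by apply: imset_f; rewrite inE.
(* The vertex over u and its M(e)-partner share a class, so the edge joining them lies inside the
   preimage. *)
- have [a aT lu] := hit u.
  have [|z zM az] := lab_perfect labl (f := e) (a := a).
    by rewrite lu e_uv !inE eqxx.
  exists z => //; have [b _ Z] := ends_other az; rewrite Z.
  apply/subsetP => c; rewrite !inE => /orP[]/eqP -> //.
  by rewrite -(comp_of_edge zM Z).
Qed.

Lemma num_col_eq :
  (forall f, f \in edges_at u v :\ e ->
     forall a b, a \in coverM C f -> b \in Me -> ends a <> ends b) ->
  num_col (cover_delete C e) = num_col C + num_col (cover_contract C e u).
Proof.
move=> nopar; rewrite num_col_delete -(card_in_imset comp_of_lost_inj).
congr (_ + #|pred_of_set _|); apply/setP => T; apply/imsetP/idP.
  by case=> S SX ->; apply: comp_of_lost_coloring.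
by case/(comp_of_lost_surj nopar) => S SX ->; exists S.
Qed.

End DeletionContraction.

(** * Full covers after deletion and contraction, and the color functions *)

Section FullCovers.
Variables (G : multigraph) (m : nat) (e : edge G) (u v : G) (C : cover_data G).
Hypotheses (m_gt0 : 0 < m) (e_uv : ends e = [set u; v]) (fC : full_cover m C).

Lemma full_cover_delete : full_cover m (cover_delete C e).
Proof.
have [l labl] := full_cover_labelling fC.
exact: labelling_full_cover m_gt0 (labelling_delete labl e).
Qed.

Lemma full_cover_contract : full_cover m (cover_contract C e u).
Proof.
have [l labl] := full_cover_labelling fC.
have [l' _ labl'] := labelling_contract labl e_uv.
exact: labelling_full_cover m_gt0 labl'.
Qed.

End FullCovers.

Import GRing.Theory Num.Theory.

Theorem theorem3 (G : multigraph) (m : nat) (m_gt0 : (0 < m)%N)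
    (e : edge G) (u v : G) (e_uv : ends e = [set u; v]) :
  [/\ forall C : cover_data G, full_cover m C ->
        ((num_col (cover_delete C e))%:Z - (num_col (cover_contract C e u))%:Z
           <= (num_col C)%:Z)%R,
      ((P_DP (delete_edge e) m)%:Z - (P_DP_dual (contract_one e) m)%:Z
         <= (P_DP G m)%:Z)%R,
      forall C : cover_data G, full_cover m C ->
        (forall f, f \in edges_at u v :\ e ->
           forall a b, a \in coverM C f -> b \in coverM C e ->
             ends a <> ends b) ->
        ((num_col C)%:Z
           = (num_col (cover_delete C e))%:Z
             - (num_col (cover_contract C e u))%:Z)%R
    & mult u v = 1%N ->
        ((P_DP_dual G m)%:Z
           <= (P_DP_dual (delete_edge e) m)%:Z
              - (P_DP (contract_one e) m)%:Z)%R].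
Proof.
have ge C : full_cover m C ->
    num_col (cover_delete C e) <= num_col C + num_col (cover_contract C e u).
  by move=> /full_cover_labelling[l labl]; exact: (num_col_ge labl e_uv).
have eqC C : full_cover m C ->
    (forall f, f \in edges_at u v :\ e ->
       forall a b, a \in coverM C f -> b \in coverM C e -> ends a <> ends b) ->
    num_col (cover_delete C e) = num_col C + num_col (cover_contract C e u).
  by move=> /full_cover_labelling[l labl]; exact: (num_col_eq labl e_uv).
have [_ minD] := P_DP_spec (delete_edge e) m_gt0.
have [_ maxD] := P_DP_dual_spec (delete_edge e) m_gt0.
have [_ minK] := P_DP_spec (contract_one e) m_gt0.
have [_ maxK] := P_DP_dual_spec (contract_one e) m_gt0.
have valD C : full_cover m C -> dp_value (delete_edge e) m (num_col (cover_delete C e)).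
  by move=> fC; exists (cover_delete C e) => //; apply: full_cover_delete.
have valK C : full_cover m C ->
    dp_value (contract_one e) m (num_col (cover_contract C e u)).
  by move=> fC; exists (cover_contract C e u) => //;
    exact: (full_cover_contract m_gt0 e_uv fC).
split.
- by move=> C /ge; rewrite lerBlDr -PoszD lez_nat.
(* C attains the minimum for G; its deletion and contraction are compared with the extrema of the
   smaller graphs. *)
- have [[C fC <-] _] := P_DP_spec G m_gt0.
  rewrite lerBlDr -PoszD lez_nat (leq_trans (minD _ (valD _ fC))) //.
  by rewrite (leq_trans (ge _ fC)) // leq_add2l maxK //; apply: valK.
- by move=> C fC /(eqC _ fC) ->; rewrite PoszD addrK.
- move=> uv1; have [[C fC <-] _] := P_DP_dual_spec G m_gt0.
  rewrite lerBrDr -PoszD lez_nat.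
  apply: leq_trans (maxD _ (valD _ fC)); rewrite eqC //.
    by rewrite leq_add2l minK //; apply: valK.
  (* With multiplicity 1 no edge is parallel to e, so the hypothesis of the equality is vacuous. *)
  move=> f; have /eqP/cards1P[g E] := uv1.
  have eg : e \in edges_at u v by apply/edges_atP.
  by move: eg; rewrite E => /set1P <-; rewrite setDv inE.
Qed.
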